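(* Let $M(X,Y)$ be the set of multirelations $X\leftrightarrow\mathcal{P}Y$ and $U=X\times\mathcal{P}(Y)$. (1) $\sqsubseteq_\downarrow$ is a preorder on $M(X,Y)$; $\Cup$ and $\Cap$ are associative and commutative operations with units $1_\Cup$ and $1_\Cap$ respectively, each monotone in both arguments with respect to $\sqsubseteq_\downarrow$; and $\emptyset\sqsubseteq_\downarrow R\sqsubseteq_\downarrow U$ for all $R$. (2) The same holds for $\sqsubseteq_\uparrow$, with least element $U$ and greatest element $\emptyset$, i.e. $U\sqsubseteq_\uparrow R\sqsubseteq_\uparrow\emptyset$ for all $R$. (3) The same holds for $\sqsubseteq_\updownarrow$ (a preorder with respect to which $\Cup$ and $\Cap$ are monotone in both arguments). (4) Inner complementation $R\mapsto\widetilde{R}$ is a bijection interchanging $\Cup$ with $\Cap$ and $1_\Cup$ with $1_\Cap$, and for all $R,S$: $R\sqsubseteq_\downarrow S\iff\widetilde{S}\sqsubseteq_\uparrow\widetilde{R}$, $R\sqsubseteq_\uparrow S\iff\widetilde{S}\sqsubseteq_\downarrow\widetilde{R}$, and $R\sqsubseteq_\updownarrow S\iff\widetilde{S}\sqsubseteq_\updownarrow\widetilde{R}$. (5) Each of $\sqsubseteq_\downarrow,\sqsubseteq_\uparrow,\sqsubseteq_\updownarrow$ (denote it $\sqsubseteq$) is a precongruence for $\cup$, $(-)^{\uparrow}$, $(-)^{\downarrow}$ and $(-)^{\updownarrow}$: if $R\sqsubseteq S$ then $R\cup T\sqsubseteq S\cup T$, $T\cup R\sqsubseteq T\cup S$,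 $R^{\uparrow}\sqsubseteq S^{\uparrow}$, $R^{\downarrow}\sqsubseteq S^{\downarrow}$ and $R^{\updownarrow}\sqsubseteq S^{\updownarrow}$. (6) Peleg composition preserves $\sqsubseteq_\downarrow$, $\sqsubseteq_\uparrow$ and $\sqsubseteq_\updownarrow$ in its second argument: if $R\sqsubseteq S$ for $R,S:Y\leftrightarrow\mathcal{P}Z$, then $T\ast R\sqsubseteq T\ast S$ for every $T:X\leftrightarrow\mathcal{P}Y$.
   Context: $R\Cup S=\{(a,A\cup B)\mid (a,A)\in R,(a,B)\in S\}$, $R\Cap S=\{(a,A\cap B)\mid (a,A)\in R,(a,B)\in S\}$, $1_\Cup=\{(a,\emptyset)\mid a\in X\}$, $1_\Cap=\{(a,Y)\mid a\in X\}$, $\widetilde{R}=\{(a,Y\setminus A)\mid (a,A)\in R\}$. $R^{\uparrow}=\{(a,A)\mid\exists B.(a,B)\in R\wedge B\subseteq A\}$, $R^{\downarrow}=\{(a,A)\mid\exists B.(a,B)\in R\wedge A\subseteq B\}$, $R^{\updownarrow}=R^{\uparrow}\cap R^{\downarrow}$. Preorders: $R\sqsubseteq_\uparrow S\iff S\subseteq R^{\uparrow}$; $R\sqsubseteq_\downarrow S\iff R\subseteq S^{\downarrow}$; $R\sqsubseteq_\updownarrow S\iff R\sqsubseteq_\downarrow S\wedge R\sqsubseteq_\uparrow S$. Peleg composition of $T:X\leftrightarrow\mathcal{P}Y$ and $S:Y\leftrightarrow\mathcal{P}Z$: $T\ast S=\{(a,C)\mid\exists B.\ (a,B)\in T\wedge\exists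 f:Y\to\mathcal{P}Z.\ (\forall b\in B.(b,f(b))\in S)\wedge C=\bigcup_{b\in B}f(b)\}$. *)

(* Defs.v *)
(* Subsets of Y are predicates Y -> Prop; a multirelation
   X <-> P Y is a predicate on pairs (a, A), i.e. X -> (Y -> Prop) -> Prop.
   Equalities between sets / multirelations are Leibniz equalities of
   predicates (extensional under funext + propext, which are whitelisted). *)
Set Implicit Arguments.

Definition pset (Y : Type) := Y -> Prop.
Definition mrel (X Y : Type) := X -> pset Y -> Prop.

Section Ops.
Variables X Y Z : Type.

Definition set_union (A B : pset Y) : pset Y := fun y => A y \/ B y.
Definition set_inter (A B : pset Y) : pset Y := fun y => A y /\ B y.
Definition set_compl (A : pset Y) : pset Y := fun y => ~ A y.
Definition set_sub (A B : pset Y) : Prop := forall y, A y -> B y.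

Definition mcup (R S : mrel X Y) : mrel X Y :=
  fun a C => exists A B, R a A /\ S a B /\ C = set_union A B.
Definition mcap (R S : mrel X Y) : mrel X Y :=
  fun a C => exists A B, R a A /\ S a B /\ C = set_inter A B.
Definition one_cup : mrel X Y := fun a C => C = (fun _ : Y => False).
Definition one_cap : mrel X Y := fun a C => C = (fun _ : Y => True).
Definition icompl (R : mrel X Y) : mrel X Y :=
  fun a C => exists A, R a A /\ C = set_compl A.

Definition up (R : mrel X Y) : mrel X Y :=
  fun a A => exists B, R a B /\ set_sub B A.
Definition down (R : mrel X Y) : mrel X Y :=
  fun a A => exists B, R a B /\ set_sub A B.
Definition updown (R : mrel X Y) : mrel X Y :=
  fun a A => up R a A /\ down R a A.

Definition mrel_sub (R S : mrel X Y) : Prop := forall a A, R a A -> S a A.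
Definition mrel_union (R S : mrel X Y) : mrel X Y := fun a A => R a A \/ S a A.
Definition mrel_empty : mrel X Y := fun _ _ => False.
Definition mrel_full : mrel X Y := fun _ _ => True.

Definition le_up (R S : mrel X Y) : Prop := mrel_sub S (up R).
Definition le_down (R S : mrel X Y) : Prop := mrel_sub R (down S).
Definition le_updown (R S : mrel X Y) : Prop := le_down R S /\ le_up R S.

End Ops.

Definition peleg (X Y Z : Type) (T : mrel X Y) (S : mrel Y Z) : mrel X Z :=
  fun a C => exists B, T a B /\
    exists f : Y -> pset Z, (forall b, B b -> S b (f b)) /\
      C = (fun z => exists b, B b /\ f b z).

Definition is_preorder (T : Type) (le : T -> T -> Prop) : Prop :=
  (forall x, le x x) /\ (forall x y z, le x y -> le y z -> le x z).

Definition monotone2 (T : Type) (le : T -> T -> Prop) (op : T -> T -> T) : Prop :=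
  forall x x' y y', le x x' -> le y y' -> le (op x y) (op x' y').

Definition assoc_comm_unit (T : Type) (op : T -> T -> T) (e : T) : Prop :=
  (forall x y z, op x (op y z) = op (op x y) z) /\
  (forall x y, op x y = op y x) /\
  (forall x, op e x = x) /\ (forall x, op x e = x).

Definition ordered_structure (X Y : Type) (le : mrel X Y -> mrel X Y -> Prop) : Prop :=
  is_preorder le /\ monotone2 le (@mcup X Y) /\ monotone2 le (@mcap X Y).

Definition precongruence (X Y : Type) (le : mrel X Y -> mrel X Y -> Prop) : Prop :=
  forall R S T : mrel X Y, le R S ->
    le (mrel_union R T) (mrel_union S T) /\
    le (mrel_union T R) (mrel_union T S) /\
    le (up R) (up S) /\ le (down R) (down S) /\ le (updown R) (updown S).

(* Main.v *)
(** Both orders are simulations lifted from a relation on sets: [R ⊑↓ S] lifts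
    [⊆] from [R] to [S], and [R ⊑↑ S] lifts [⊇] from [S] to [R].  Any lift of a
    preorder is a preorder; the pointwise lifts ⋓, ⋒ of [∪], [∩] are monotone
    for it as soon as [∪], [∩] are monotone for the set relation, and Peleg
    composition is monotone in its second argument as soon as arbitrary unions
    are (the witnessing family being picked by choice).  Each of [(-)↑],
    [(-)↓], [(-)↕] returns a relation equivalent to its argument for at least
    one of the two orders, which gives the precongruence properties there; in
    the two remaining cases an [A] generated by [B] is matched by [A ∪ B'] resp.
    [A ∩ B'], where [B'] is the set matched with [B].  Inner complementation is an
    involution turning [⊆] into [⊇], hence it exchanges ⋓ with ⋒ and [⊑↓]
    with the converse of [⊑↑]. *)

Require Import Defs.
From Stdlib Require Import Classical ClassicalEpsilon FunctionalExtensionality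
  PropExtensionality.

Set Implicit Arguments.

Lemma choice_on (I C : Type) (D : I -> Prop) (P : I -> C -> Prop) :
  inhabited C -> (forall i, D i -> exists c, P i c) ->
  exists g : I -> C, forall i, D i -> P i (g i).
Proof.
  intros [c0] H. apply (choice (fun i c => D i -> P i c)). intro i.
  destruct (classic (D i)) as [Hi | Hi].
  - destruct (H i Hi) as [c Hc]. exists c. intros _. exact Hc.
  - exists c0. intro Hi'. contradiction.
Qed.

Lemma is_preorder_and (T : Type) (le1 le2 : T -> T -> Prop) :
  is_preorder le1 -> is_preorder le2 -> is_preorder (fun x y => le1 x y /\ le2 x y).
Proof. intros [r1 t1] [r2 t2]. split; [auto | intros x y z [] []; eauto]. Qed.

Lemma monotone2_and (T : Type) (le1 le2 : T -> T -> Prop) (op : T -> T -> T) :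
  monotone2 le1 op -> monotone2 le2 op -> monotone2 (fun x y => le1 x y /\ le2 x y) op.
Proof. intros H1 H2 x x' y y' [] []. split; auto. Qed.

Lemma is_preorder_flip (T : Type) (le : T -> T -> Prop) :
  is_preorder le -> is_preorder (fun x y => le y x).
Proof. intros [r t]. split; eauto. Qed.

Lemma monotone2_flip (T : Type) (le : T -> T -> Prop) (op : T -> T -> T) :
  monotone2 le op -> monotone2 (fun x y => le y x) op.
Proof. intros H x x' y y'. apply H. Qed.

Lemma preorder_mono_of_equiv (T : Type) (le : T -> T -> Prop) (F : T -> T) :
  is_preorder le -> (forall x, le (F x) x /\ le x (F x)) ->
  forall x y, le x y -> le (F x) (F y).
Proof.
  intros [_ t] HF x y Hxy.
  apply t with y; [apply t with x |]; [apply HF | exact Hxy | apply HF].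
Qed.

Definition set_sup (Y : Type) (A B : pset Y) : Prop := set_sub B A.

Definition set_bigcup (I Y : Type) (B : pset I) (F : I -> pset Y) : pset Y :=
  fun y => exists i, B i /\ F i y.

Definition bigcup_monotone (Y : Type) (r : pset Y -> pset Y -> Prop) : Prop :=
  forall (I : Type) (B : pset I) (F G : I -> pset Y),
    (forall i, B i -> r (F i) (G i)) -> r (set_bigcup B F) (set_bigcup B G).

Section Sets.
Variable Y : Type.
Implicit Types A B : pset Y.

Lemma set_ext A B : (forall y, A y <-> B y) -> A = B.
Proof.
  intro H. apply functional_extensionality. intro y.
  apply propositional_extensionality, H.
Qed.

Ltac set_solve := apply set_ext;
  unfold set_union, set_inter, set_compl; firstorder.

Lemma set_union_acu : assoc_comm_unit (@set_union Y) (fun _ => False).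
Proof. repeat split; intros; set_solve. Qed.

Lemma set_inter_acu : assoc_comm_unit (@set_inter Y) (fun _ => True).
Proof. repeat split; intros; set_solve. Qed.

Lemma set_complK A : set_compl (set_compl A) = A.
Proof. apply set_ext. intro y. split; [apply NNPP | intros H HnA; exact (HnA H)]. Qed.

Lemma set_compl_union A B :
  set_compl (set_union A B) = set_inter (set_compl A) (set_compl B).
Proof. set_solve. Qed.

Lemma set_compl_sub A B : set_sub (set_compl A) B -> set_sub (set_compl B) A.
Proof. intros H y HB. apply NNPP. intro HA. exact (HB (H y HA)). Qed.

Lemma set_sub_compl A B : set_sub A (set_compl B) -> set_sub B (set_compl A).
Proof. intros H y HB HA. exact (H y HA HB). Qed.

Lemma set_sub_refl A : set_sub A A.
Proof. intros y H. exact H. Qed.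

Lemma set_sub_preorder : is_preorder (@set_sub Y).
Proof. split; [exact set_sub_refl | intros A B C H1 H2 y Hy; auto]. Qed.

Lemma set_sup_preorder : is_preorder (@set_sup Y).
Proof. exact (is_preorder_flip set_sub_preorder). Qed.

Lemma set_sub_union : monotone2 (@set_sub Y) (@set_union Y).
Proof. unfold set_sub, set_union. firstorder. Qed.

Lemma set_sub_inter : monotone2 (@set_sub Y) (@set_inter Y).
Proof. unfold set_sub, set_inter. firstorder. Qed.

Lemma set_sub_bigcup : bigcup_monotone (@set_sub Y).
Proof. unfold set_sub, set_bigcup. firstorder. Qed.

Lemma set_sup_bigcup : bigcup_monotone (@set_sup Y).
Proof. unfold set_sup, set_sub, set_bigcup. firstorder. Qed.

End Sets.

Section Multirelations.
Variables X Y : Type.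
Implicit Types R S T : mrel X Y.

Lemma mrel_ext R S : (forall a C, R a C <-> S a C) -> R = S.
Proof.
  intro H. apply functional_extensionality. intro a.
  apply functional_extensionality. intro C. apply propositional_extensionality, H.
Qed.

(** [le_down R S] is [mrel_sim set_sub R S] and [le_up R S] is
    [mrel_sim (@set_sup Y) S R], both by conversion. *)
Definition mrel_sim (r : pset Y -> pset Y -> Prop) R S : Prop :=
  forall a A, R a A -> exists B, S a B /\ r A B.

(** [mcup], [mcap], [one_cup], [one_cap] are, by conversion, [mrel_op2 set_union],
    [mrel_op2 set_inter], [mrel_const (fun _ => False)], [mrel_const (fun _ => True)]. *)
Definition mrel_op2 (op : pset Y -> pset Y -> pset Y) R S : mrel X Y :=
  fun a C => exists A B, R a A /\ S a B /\ C = op A B.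

Definition mrel_const (E : pset Y) : mrel X Y := fun _ C => C = E.

Lemma mrel_op2_acu op E :
  assoc_comm_unit op E -> assoc_comm_unit (mrel_op2 op) (mrel_const E).
Proof.
  intros (opA & opC & op1 & opE).
  repeat split; intros; apply mrel_ext; intros a C; split.
  - intros (A & BD & HA & (B & D & HB & HD & ->) & ->).
    exists (op A B), D. rewrite opA. split; [exists A, B |]; auto.
  - intros (AB & D & (A & B & HA & HB & ->) & HD & ->).
    exists A, (op B D). rewrite opA. split; [| split; [exists B, D |]]; auto.
  - intros (A & B & HA & HB & ->). exists B, A. auto.
  - intros (A & B & HA & HB & ->). exists B, A. auto.
  - intros (A & B & -> & HB & ->). rewrite op1. exact HB.
  - intro HC. exists E, C. unfold mrel_const. auto.
  - intros (A & B & HA & -> & ->). rewrite opE. exact HA.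
  - intro HC. exists C, E. unfold mrel_const. auto.
Qed.

Section Sim.
Variable r : pset Y -> pset Y -> Prop.
Hypothesis r_refl : forall A, r A A.

Lemma mrel_sim_of_sub R S : mrel_sub R S -> mrel_sim r R S.
Proof. intros H a A HA. exists A. auto. Qed.

Lemma mrel_sim_empty R : mrel_sim r (@mrel_empty X Y) R.
Proof. intros a A []. Qed.

Lemma mrel_sim_full R : mrel_sim r R (@mrel_full X Y).
Proof. apply mrel_sim_of_sub. intros a A _. exact I. Qed.

Lemma mrel_sim_union_r R S T :
  mrel_sim r R S -> mrel_sim r (mrel_union R T) (mrel_union S T).
Proof.
  intros H a A [HA | HA].
  - destruct (H a A HA) as (B & HB & HAB). exists B. split; [left |]; auto.
  - exists A. split; [right |]; auto.
Qed.

Lemma mrel_sim_union_l R S T :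
  mrel_sim r R S -> mrel_sim r (mrel_union T R) (mrel_union T S).
Proof.
  intros H a A [HA | HA].
  - exists A. split; [left |]; auto.
  - destruct (H a A HA) as (B & HB & HAB). exists B. split; [right |]; auto.
Qed.

End Sim.

Lemma mrel_sim_preorder r : is_preorder r -> is_preorder (mrel_sim r).
Proof.
  intros [refl trans]. split.
  - intros R a A HA. exists A. auto.
  - intros R S T H1 H2 a A HA.
    destruct (H1 a A HA) as (B & HB & HAB).
    destruct (H2 a B HB) as (C & HC & HBC).
    exists C. eauto.
Qed.

Lemma mrel_sim_op2 r op : monotone2 r op -> monotone2 (mrel_sim r) (mrel_op2 op).
Proof.
  intros Hop R R' S S' HR HS a C (A & B & HA & HB & ->).
  destruct (HR a A HA) as (A' & HA' & rA).
  destruct (HS a B HB) as (B' & HB' & rB).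
  exists (op A' B'). split; [exists A', B' |]; auto.
Qed.

Lemma ordered_structure_mrel_sim r :
  is_preorder r -> monotone2 r (@set_union Y) -> monotone2 r (@set_inter Y) ->
  ordered_structure (mrel_sim r).
Proof.
  intros Hr Hcup Hcap.
  split; [| split]; [apply mrel_sim_preorder | apply mrel_sim_op2 ..]; assumption.
Qed.

Lemma ordered_structure_le_down : ordered_structure (@le_down X Y).
Proof.
  apply ordered_structure_mrel_sim;
    [apply set_sub_preorder | apply set_sub_union | apply set_sub_inter].
Qed.

Lemma ordered_structure_le_up : ordered_structure (@le_up X Y).
Proof.
  destruct (ordered_structure_mrel_sim (set_sup_preorder Y)
              (monotone2_flip (@set_sub_union Y)) (monotone2_flip (@set_sub_inter Y)))
    as (Hpre & Hcup & Hcap).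
  split; [apply is_preorder_flip | split; apply monotone2_flip]; assumption.
Qed.

Lemma ordered_structure_le_updown : ordered_structure (@le_updown X Y).
Proof.
  destruct ordered_structure_le_down as (Hd & Hdcup & Hdcap).
  destruct ordered_structure_le_up as (Hu & Hucup & Hucap).
  split; [apply is_preorder_and | split; apply monotone2_and]; assumption.
Qed.

Lemma le_down_down_equiv R : le_down (down R) R /\ le_down R (down R).
Proof.
  split; [intros a A HA; exact HA |].
  apply mrel_sim_of_sub; [apply set_sub_refl |].
  intros a A HA. exists A. split; [exact HA | apply set_sub_refl].
Qed.

Lemma le_down_updown_equiv R : le_down (updown R) R /\ le_down R (updown R).
Proof.
  split; [intros a A HA; exact (proj2 HA) |].
  apply mrel_sim_of_sub; [apply set_sub_refl |].
  intros a A HA. split; exists A; split; (exact HA || apply set_sub_refl).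
Qed.

Lemma le_up_up_equiv R : le_up (up R) R /\ le_up R (up R).
Proof.
  split; [| intros a A HA; exact HA].
  apply mrel_sim_of_sub; [apply set_sub_refl |].
  intros a A HA. exists A. split; [exact HA | apply set_sub_refl].
Qed.

Lemma le_up_updown_equiv R : le_up (updown R) R /\ le_up R (updown R).
Proof.
  split; [| intros a A HA; exact (proj1 HA)].
  apply mrel_sim_of_sub; [apply set_sub_refl |].
  intros a A HA. split; exists A; split; (exact HA || apply set_sub_refl).
Qed.

Lemma le_down_up R S : le_down R S -> le_down (up R) (up S).
Proof.
  intros H a A (B & HB & HBA).
  destruct (H a B HB) as (B' & HB' & HBB').
  exists (set_union A B'). split.
  - exists B'. split; [exact HB' | intros y Hy; right; exact Hy].
  - intros y Hy. left. exact Hy.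
Qed.

Lemma le_up_down R S : le_up R S -> le_up (down R) (down S).
Proof.
  intros H a A (B & HB & HAB).
  destruct (H a B HB) as (B' & HB' & HB'B).
  exists (set_inter A B'). split.
  - exists B'. split; [exact HB' | intros y Hy; exact (proj2 Hy)].
  - intros y Hy. exact (proj1 Hy).
Qed.

Lemma precongruence_le_down : precongruence (@le_down X Y).
Proof.
  destruct ordered_structure_le_down as (Hpre & _).
  intros R S T H. repeat split.
  - exact (mrel_sim_union_r (@set_sub_refl Y) H).
  - exact (mrel_sim_union_l (@set_sub_refl Y) H).
  - exact (le_down_up H).
  - exact (preorder_mono_of_equiv _ Hpre le_down_down_equiv _ _ H).
  - exact (preorder_mono_of_equiv _ Hpre le_down_updown_equiv _ _ H).
Qed.

Lemma precongruence_le_up : precongruence (@le_up X Y).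
Proof.
  destruct ordered_structure_le_up as (Hpre & _).
  intros R S T H. repeat split.
  - exact (mrel_sim_union_r (r := @set_sup Y) (@set_sub_refl Y) H).
  - exact (mrel_sim_union_l (r := @set_sup Y) (@set_sub_refl Y) H).
  - exact (preorder_mono_of_equiv _ Hpre le_up_up_equiv _ _ H).
  - exact (le_up_down H).
  - exact (preorder_mono_of_equiv _ Hpre le_up_updown_equiv _ _ H).
Qed.

Lemma precongruence_le_updown : precongruence (@le_updown X Y).
Proof.
  intros R S T [Hd Hu].
  destruct (precongruence_le_down T Hd) as (d1 & d2 & d3 & d4 & d5).
  destruct (precongruence_le_up T Hu) as (u1 & u2 & u3 & u4 & u5).
  repeat split; assumption.
Qed.

Lemma icomplE R a C : icompl R a C <-> R a (set_compl C).
Proof.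
  split.
  - intros (A & HA & ->). rewrite set_complK. exact HA.
  - intro H. exists (set_compl C). rewrite set_complK. auto.
Qed.

Lemma icomplK R : icompl (icompl R) = R.
Proof. apply mrel_ext. intros a C. rewrite !icomplE, set_complK. reflexivity. Qed.

Lemma icompl_inj R S : icompl R = icompl S -> R = S.
Proof. intro H. rewrite <- (icomplK R), <- (icomplK S), H. reflexivity. Qed.

Lemma icompl_mcup R S : icompl (mcup R S) = mcap (icompl R) (icompl S).
Proof.
  apply mrel_ext. intros a C. split.
  - intros (AB & (A & B & HA & HB & ->) & ->).
    exists (set_compl A), (set_compl B).
    repeat split; [exists A | exists B | apply set_compl_union]; auto.
  - intros (A' & B' & (A & HA & ->) & (B & HB & ->) & ->).
    exists (set_union A B).
    split; [exists A, B | symmetry; apply set_compl_union]; auto.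
Qed.

Lemma icompl_mcap R S : icompl (mcap R S) = mcup (icompl R) (icompl S).
Proof.
  rewrite <- (icomplK (mcup (icompl R) (icompl S))), icompl_mcup, !icomplK.
  reflexivity.
Qed.

Lemma icompl_one_cup : icompl (@one_cup X Y) = @one_cap X Y.
Proof.
  apply mrel_ext. intros a C. split.
  - intros (A & -> & ->). apply set_ext. unfold set_compl. tauto.
  - intros ->. exists (fun _ => False).
    split; [reflexivity | apply set_ext; unfold set_compl; tauto].
Qed.

Lemma icompl_one_cap : icompl (@one_cap X Y) = @one_cup X Y.
Proof. rewrite <- icompl_one_cup, icomplK. reflexivity. Qed.

Lemma le_down_icompl R S : le_down R S <-> le_up (icompl S) (icompl R).
Proof.
  split.
  - intros H a A HA. apply icomplE in HA.
    destruct (H a _ HA) as (B & HB & HAB).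
    exists (set_compl B). split.
    + apply icomplE. rewrite set_complK. exact HB.
    + exact (set_compl_sub HAB).
  - intros H a A HA.
    assert (HcA : icompl R a (set_compl A)) by (apply icomplE; rewrite set_complK; exact HA).
    destruct (H a _ HcA) as (B & HB & HBA).
    exists (set_compl B). split.
    + apply icomplE in HB. exact HB.
    + exact (set_sub_compl HBA).
Qed.

Lemma le_up_icompl R S : le_up R S <-> le_down (icompl S) (icompl R).
Proof. rewrite le_down_icompl, !icomplK. reflexivity. Qed.

Lemma le_updown_icompl R S : le_updown R S <-> le_updown (icompl S) (icompl R).
Proof.
  pose proof (le_down_icompl R S). pose proof (le_up_icompl R S).
  unfold le_updown. tauto.
Qed.

End Multirelations.

Lemma mrel_sim_peleg (X Y Z : Type) (r : pset Z -> pset Z -> Prop)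
  (T : mrel X Y) (R S : mrel Y Z) :
  bigcup_monotone r -> mrel_sim r R S -> mrel_sim r (peleg T R) (peleg T S).
Proof.
  intros Hr H a C (B & HB & f & Hf & ->).
  destruct (choice_on B (fun b D => S b D /\ r (f b) D)) as [g Hg].
  - exact (inhabits (fun _ => False)).
  - intros b Hb. exact (H b (f b) (Hf b Hb)).
  - exists (set_bigcup B g). split.
    + exists B. split; [exact HB |]. exists g.
      split; [intros b Hb; apply (Hg b Hb) | reflexivity].
    + apply Hr. intros b Hb. apply (Hg b Hb).
Qed.

Theorem proposition5p3 (X Y Z : Type) :
  (* (1) *)
  (ordered_structure (@le_down X Y) /\
   assoc_comm_unit (@mcup X Y) (@one_cup X Y) /\
   assoc_comm_unit (@mcap X Y) (@one_cap X Y) /\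
   (forall R : mrel X Y, le_down (@mrel_empty X Y) R /\ le_down R (@mrel_full X Y))) /\
  (* (2) *)
  (ordered_structure (@le_up X Y) /\
   (forall R : mrel X Y, le_up (@mrel_full X Y) R /\ le_up R (@mrel_empty X Y))) /\
  (* (3) *)
  ordered_structure (@le_updown X Y) /\
  (* (4) *)
  ((forall R S : mrel X Y, icompl R = icompl S -> R = S) /\
   (forall S : mrel X Y, exists R, icompl R = S) /\
   (forall R S : mrel X Y, icompl (mcup R S) = mcap (icompl R) (icompl S)) /\
   (forall R S : mrel X Y, icompl (mcap R S) = mcup (icompl R) (icompl S)) /\
   icompl (@one_cup X Y) = @one_cap X Y /\
   icompl (@one_cap X Y) = @one_cup X Y /\
   (forall R S : mrel X Y,
      (le_down R S <-> le_up (icompl S) (icompl R)) /\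
      (le_up R S <-> le_down (icompl S) (icompl R)) /\
      (le_updown R S <-> le_updown (icompl S) (icompl R)))) /\
  (* (5) *)
  (precongruence (@le_down X Y) /\ precongruence (@le_up X Y) /\
   precongruence (@le_updown X Y)) /\
  (* (6) *)
  (forall (T : mrel X Y) (R S : mrel Y Z),
     (le_down R S -> le_down (peleg T R) (peleg T S)) /\
     (le_up R S -> le_up (peleg T R) (peleg T S)) /\
     (le_updown R S -> le_updown (peleg T R) (peleg T S))).
Proof.
  split; [| split; [| split; [| split; [| split]]]].
  - refine (conj (ordered_structure_le_down X Y) (conj (mrel_op2_acu X (@set_union_acu Y))
      (conj (mrel_op2_acu X (@set_inter_acu Y)) _))).
    intro R. split; [apply mrel_sim_empty | apply mrel_sim_full, set_sub_refl].
  - split; [apply ordered_structure_le_up |].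
    intro R. split; [apply mrel_sim_full, set_sub_refl | apply mrel_sim_empty].
  - apply ordered_structure_le_updown.
  - refine (conj (@icompl_inj X Y) (conj _ (conj (@icompl_mcup X Y) (conj (@icompl_mcap X Y)
      (conj (icompl_one_cup X Y) (conj (icompl_one_cap X Y) _)))))).
    + intro S. exists (icompl S). apply icomplK.
    + intros R S. split; [| split];
        [apply le_down_icompl | apply le_up_icompl | apply le_updown_icompl].
  - split; [| split];
      [apply precongruence_le_down | apply precongruence_le_up | apply precongruence_le_updown].
  - intros T R S.
    assert (Hdown : le_down R S -> le_down (peleg T R) (peleg T S))
      by (apply mrel_sim_peleg, set_sub_bigcup).
    assert (Hup : le_up R S -> le_up (peleg T R) (peleg T S))
      by (apply mrel_sim_peleg, set_sup_bigcup).
    split; [| split]; [exact Hdown | exact Hup |].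
    intros [H1 H2]. split; auto.
Qed.
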